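(* There are no subalgebras of $\mathfrak{so}(4,\mathbb{C})$ isomorphic to $L_1$, the abelian complex Lie algebra of dimension $3$.
   Context: $\mathfrak{so}(4,\mathbb{C})\cong\mathfrak{sl}(2,\mathbb{C})\oplus\mathfrak{sl}(2,\mathbb{C})$ is realized as the Lie algebra of $4\times4$ complex block diagonal matrices with two traceless $2\times 2$ diagonal blocks. Subalgebras are complex Lie subalgebras. *)

(* Defs.v *)
From HB Require Import structures.
From mathcomp Require Import all_boot all_order all_algebra.
From mathcomp Require Import ring.

Set Implicit Arguments.
Unset Strict Implicit.
Unset Printing Implicit Defensive.

Import GRing.Theory.

Local Open Scope ring_scope.

HB.mixin Record Vector_isLie (K : fieldType) L of Vector K L := {
  lie : L -> L -> L;
  lieDl : forall x y z : L, lie (x + y) z = lie x z + lie y z;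
  lieZl : forall (a : K) (x y : L), lie (a *: x) y = a *: lie x y;
  lieDr : forall x y z : L, lie x (y + z) = lie x y + lie x z;
  lieZr : forall (a : K) (x y : L), lie x (a *: y) = a *: lie x y;
  liexx : forall x : L, lie x x = 0;
  lie_jacobi : forall x y z : L,
    lie x (lie y z) + lie y (lie z x) + lie z (lie x y) = 0
}.

(* Finite-dimensional Lie algebras over K. *)
#[short(type="lieAlgType")]
HB.structure Definition LieAlgebra (K : fieldType) :=
  {L of Vector K L & Vector_isLie K L}.

Definition lie_isom (K : fieldType) (L M : lieAlgType K) : Prop :=
  exists f : {linear L -> M},
    bijective f /\ forall x y : L, f (lie x y) = lie (f x) (f y).

Definition lie_closed (K : fieldType) (L : lieAlgType K) (U : {vspace L}) : Prop :=
  forall x y : L, x \in U -> y \in U -> lie x y \in U.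

Record lieSubalg (K : fieldType) (L : lieAlgType K) := LieSubalg {
  lsub_vspace :> {vspace L};
  lsub_closed : lie_closed lsub_vspace
}.

Section SubalgebraLie.
Variables (K : fieldType) (L : lieAlgType K) (h : lieSubalg L).
Implicit Types x y z : subvs_of h.

Definition sub_lie x y : subvs_of h :=
  Subvs (lsub_closed (subvsP x) (subvsP y)).

Fact sub_lieDl x y z : sub_lie (x + y) z = sub_lie x z + sub_lie y z.
Proof. by apply: val_inj; rewrite /= lieDl. Qed.

Fact sub_lieZl (a : K) x y : sub_lie (a *: x) y = a *: sub_lie x y.
Proof. by apply: val_inj; rewrite /= lieZl. Qed.

Fact sub_lieDr x y z : sub_lie x (y + z) = sub_lie x y + sub_lie x z.
Proof. by apply: val_inj; rewrite /= lieDr. Qed.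

Fact sub_lieZr (a : K) x y : sub_lie x (a *: y) = a *: sub_lie x y.
Proof. by apply: val_inj; rewrite /= lieZr. Qed.

Fact sub_liexx x : sub_lie x x = 0.
Proof. by apply: val_inj; rewrite /= liexx. Qed.

Fact sub_lie_jacobi x y z :
  sub_lie x (sub_lie y z) + sub_lie y (sub_lie z x)
  + sub_lie z (sub_lie x y) = 0.
Proof. by apply: val_inj; rewrite /= lie_jacobi. Qed.

HB.instance Definition _ := Vector_isLie.Build K (subvs_of h)
  sub_lieDl sub_lieZl sub_lieDr sub_lieZr sub_liexx sub_lie_jacobi.

End SubalgebraLie.

(* Alias of 'rV[K]_n, so that the zero bracket does not compete with the      *)
(* commutator on square matrices.                                             *)
Definition abelian_lie (K : fieldType) (n : nat) : Type := 'rV[K]_n.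

Section AbelianLie.
Variables (K : fieldType) (n : nat).

HB.instance Definition _ := Vector.copy (abelian_lie K n) 'rV[K]_n.

Definition abelian_br (x y : abelian_lie K n) : abelian_lie K n := 0.

Fact abelian_brDl x y z :
  abelian_br (x + y) z = abelian_br x z + abelian_br y z.
Proof. by rewrite /abelian_br addr0. Qed.

Fact abelian_brZl (a : K) x y : abelian_br (a *: x) y = a *: abelian_br x y.
Proof. by rewrite /abelian_br scaler0. Qed.

Fact abelian_brDr x y z :
  abelian_br x (y + z) = abelian_br x y + abelian_br x z.
Proof. by rewrite /abelian_br addr0. Qed.

Fact abelian_brZr (a : K) x y : abelian_br x (a *: y) = a *: abelian_br x y.
Proof. by rewrite /abelian_br scaler0. Qed.

Fact abelian_brxx x : abelian_br x x = 0.
Proof. by []. Qed.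

Fact abelian_br_jacobi x y z :
  abelian_br x (abelian_br y z) + abelian_br y (abelian_br z x)
  + abelian_br z (abelian_br x y) = 0.
Proof. by rewrite /abelian_br !addr0. Qed.

HB.instance Definition _ := Vector_isLie.Build K (abelian_lie K n)
  abelian_brDl abelian_brZl abelian_brDr abelian_brZr
  abelian_brxx abelian_br_jacobi.

End AbelianLie.

Definition gl (K : fieldType) (n : nat) : Type := 'M[K]_n.

Section GeneralLinearLie.
Variables (K : fieldType) (n : nat).

HB.instance Definition _ := Vector.copy (gl K n) 'M[K]_n.

Definition commutator_mx (A B : gl K n) : gl K n := A *m B - B *m A.

Fact commutator_mxDl A B C :
  commutator_mx (A + B) C = commutator_mx A C + commutator_mx B C.
Proof.
by rewrite /commutator_mx (mulmxDl A B) (mulmxDr C A) opprD addrACA.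
Qed.

Fact commutator_mxZl (a : K) A B :
  commutator_mx (a *: A) B = a *: commutator_mx A B.
Proof. by rewrite /commutator_mx -scalemxAl -scalemxAr scalerBr. Qed.

Fact commutator_mxxx A : commutator_mx A A = 0.
Proof. exact: subrr. Qed.

Fact commutator_mxC A B : commutator_mx A B = - commutator_mx B A.
Proof. by rewrite /commutator_mx opprB. Qed.

Fact commutator_mxDr A B C :
  commutator_mx A (B + C) = commutator_mx A B + commutator_mx A C.
Proof. by rewrite ![commutator_mx A _]commutator_mxC commutator_mxDl opprD. Qed.

Fact commutator_mxZr (a : K) A B :
  commutator_mx A (a *: B) = a *: commutator_mx A B.
Proof. by rewrite ![commutator_mx A _]commutator_mxC commutator_mxZl scalerN. Qed.

Fact commutator_mx_jacobi A B C :
  commutator_mx A (commutator_mx B C) + commutator_mx B (commutator_mx C A)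
  + commutator_mx C (commutator_mx A B) = 0.
Proof.
rewrite /commutator_mx !(mulmxBl, mulmxBr) !mulmxA !opprB.
apply/matrixP => i j; rewrite !mxE; ring.
Qed.

HB.instance Definition _ := Vector_isLie.Build K (gl K n)
  commutator_mxDl commutator_mxZl commutator_mxDr commutator_mxZr
  commutator_mxxx commutator_mx_jacobi.

End GeneralLinearLie.

Section So4.
Variable K : fieldType.

Definition sl2_vspace : {vspace 'M[K]_2} :=
  lker (linfun (mxtrace : 'M[K]_2 -> K^o)).

Definition ul_block (a : 'M[K]_2) : gl K 4 := block_mx a 0 0 (0 : 'M_2).
Definition dr_block (b : 'M[K]_2) : gl K 4 := block_mx (0 : 'M_2) 0 0 b.

Fact ul_block_linear : linear ul_block.
Proof.
move=> c a b.
rewrite -[RHS]/(c *: block_mx a 0 0 0 + block_mx b 0 0 0 : 'M[K]_(2 + 2)).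
by rewrite scale_block_mx add_block_mx !scaler0 !addr0.
Qed.

Fact dr_block_linear : linear dr_block.
Proof.
move=> c a b.
rewrite -[RHS]/(c *: block_mx 0 0 0 a + block_mx 0 0 0 b : 'M[K]_(2 + 2)).
by rewrite scale_block_mx add_block_mx !scaler0 !addr0.
Qed.

HB.instance Definition _ :=
  GRing.isLinear.Build K 'M[K]_2 (gl K 4) _ ul_block ul_block_linear.
HB.instance Definition _ :=
  GRing.isLinear.Build K 'M[K]_2 (gl K 4) _ dr_block dr_block_linear.

(* so(4) in the realization sl(2) (+) sl(2) by block diagonal matrices, see    *)
(* mem_so4; not the skew-symmetric matrices, to which it is isomorphic over C *)
Definition so4_vspace : {vspace gl K 4} :=
  (linfun ul_block @: sl2_vspace + linfun dr_block @: sl2_vspace)%VS.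

Lemma mem_sl2 (a : 'M[K]_2) : (a \in sl2_vspace) = (\tr a == 0).
Proof. by rewrite memv_ker lfunE. Qed.

Lemma mem_so4 (A : gl K 4) :
  A \in so4_vspace <->
  exists a b : 'M[K]_2,
    [/\ \tr a = 0, \tr b = 0 & A = block_mx a 0 0 b :> 'M_(2 + 2)].
Proof.
have addE (a b : 'M[K]_2) :
    ul_block a + dr_block b = block_mx a 0 0 b :> 'M_(2 + 2).
  rewrite -[LHS]/(block_mx a 0 0 0 + block_mx 0 0 0 b : 'M[K]_(2 + 2)).
  by rewrite add_block_mx !(addr0, add0r).
split=> [/memv_addP[_ /memv_imgP[a aP ->] [_ /memv_imgP[b bP ->] ->]] |].
  exists a, b; move: aP bP; rewrite !mem_sl2 => /eqP aP /eqP bP.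
  by split=> //; rewrite !lfunE /= addE.
move=> [a [b [aP bP ->]]]; rewrite -addE; apply: memv_add.
  by apply/memv_imgP; exists a; rewrite ?lfunE // mem_sl2 aP.
by apply/memv_imgP; exists b; rewrite ?lfunE // mem_sl2 bP.
Qed.

Fact so4_closed : lie_closed so4_vspace.
Proof.
move=> A B /mem_so4[a [b [aP bP ->]]] /mem_so4[c [d [cP dP ->]]].
apply/mem_so4; exists (a *m c - c *m a), (b *m d - d *m b); split.
- by rewrite raddfB /= mxtrace_mulC subrr.
- by rewrite raddfB /= mxtrace_mulC subrr.
rewrite -[lie _ _]/(block_mx a 0 0 b *m block_mx c 0 0 d
  - block_mx c 0 0 d *m block_mx a 0 0 b : 'M[K]_(2 + 2)).
rewrite !mulmx_block !(mulmx0, mul0mx, addr0, add0r).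
by rewrite opp_block_mx add_block_mx oppr0 !addr0.
Qed.

Definition so4 : lieSubalg (gl K 4) := LieSubalg so4_closed.

End So4.

(* Main.v *)
(** An abelian subspace of sl(2) has dimension at most one, since commuting
    traceless 2x2 matrices are proportional.  The two block projections of an
    abelian subspace W of sl(2) (+) sl(2) are abelian, and W embeds in their
    sum, so it has dimension at most two. *)
Require Import Defs.
From HB Require Import structures.
From mathcomp Require Import all_boot all_order all_algebra.
From mathcomp Require Import reals complex.
From mathcomp Require Import ring.

Set Implicit Arguments.
Unset Strict Implicit.
Unset Printing Implicit Defensive.

Import GRing.Theory Num.Theory.

Local Open Scope ring_scope.
Local Open Scope complex_scope.

(** For traceless matrices the entries of [a *m b - b *m a] are, up to sign and factors of 2, the
    2x2 minors of the pair of coordinate vectors of [a] and [b]. The conclusion is proportionality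
    without division, so neither matrix has to be nonzero. *)
Lemma sl2_comm_minors (K : fieldType) (a b : 'M[K]_2) :
  2%:R != 0 :> K -> \tr a = 0 -> \tr b = 0 -> a *m b = b *m a ->
  forall i j k l, b i j * a k l = a i j * b k l.
Proof.
move=> nz2 tra trb comab.
have tr2 (c : 'M[K]_2) : \tr c = 0 -> c 1 1 = - c 0 0.
  have e1 : lift 0 0 = 1 :> 'I_2 by apply: val_inj.
  rewrite /mxtrace !big_ord_recl big_ord0 addr0 e1 => /eqP.
  by rewrite addrC addr_eq0 => /eqP.
have entry i j : a i 0 * b 0 j + a i 1 * b 1 j = b i 0 * a 0 j + b i 1 * a 1 j.
  have := congr1 (fun m : 'M[K]_2 => m i j) comab.
  have e1 : lift 0 0 = 1 :> 'I_2 by apply: val_inj.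
  by rewrite !mxE !big_ord_recl !big_ord0 !addr0 !e1.
have a11 := tr2 _ tra; have b11 := tr2 _ trb.
have dbl0 x : x + x = 0 -> x = 0 :> K.
  by rewrite -mulr2n -mulr_natl => /eqP; rewrite mulf_eq0 (negPf nz2) => /eqP.
have h1 : a 0 1 * b 1 0 = b 0 1 * a 1 0.
  by move: (entry 0 0); rewrite mulrC => /addrI.
(* With [a 1 1] and [b 1 1] eliminated, each off-diagonal entry of the commutator is twice a minor
   up to sign, so 2 has to be cancelled here and in [h3]. *)
have h2 : a 0 0 * b 0 1 = b 0 0 * a 0 1.
  apply/eqP; rewrite -subr_eq0; apply/eqP/dbl0; move/eqP: (entry 0 1).
  by rewrite a11 b11 -subr_eq0 => /eqP <-; ring.
have h3 : a 0 0 * b 1 0 = b 0 0 * a 1 0.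
  apply/eqP; rewrite -subr_eq0; apply/eqP/dbl0; move/eqP: (entry 1 0).
  by rewrite a11 b11 eq_sym -subr_eq0 => /eqP <-; ring.
have I2 (i : 'I_2) : i = 0 \/ i = 1.
  by case: i => [[|[|//]] p]; [left | right]; apply: val_inj.
move=> i j k l.
case: (I2 i) => ->; case: (I2 j) => ->; case: (I2 k) => ->; case: (I2 l) => ->;
  rewrite ?a11 ?b11; first [ring | ring: h1 | ring: h2 | ring: h3].
Qed.

Lemma sl2_comm_dim (K : fieldType) (U : {vspace 'M[K]_2}) :
  2%:R != 0 :> K -> (U <= sl2_vspace K)%VS ->
  {in U &, forall a b, a *m b = b *m a} -> (\dim U <= 1)%N.
Proof.
move=> nz2 /subvP sU comU; set u := vpick U.
have uU : u \in U by exact: memv_pick.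
have tr0 a : a \in U -> \tr a = 0 by move/sU; rewrite mem_sl2 => /eqP.
have [u0|] := eqVneq u 0.
  by move/eqP: u0; rewrite vpick0 => /eqP->; rewrite dimv0.
move=> unz; have [/existsP[i /existsP[j uij]]|no] :=
    boolP [exists i, exists j, u i j != 0]; last first.
  case/negP: no; apply: contraNT unz => no; apply/eqP/matrixP => i j.
  rewrite mxE; apply/eqP; apply: contraNT no => uij.
  by apply/existsP; exists i; apply/existsP; exists j.
suff /dimvS : (U <= <[u]>)%VS by move/leq_trans; apply; rewrite dim_vline leq_b1.
(* The factor is forced by comparing [v] with [u] at the nonzero entry [u i j]; the minors extend it
   to all entries. *)
apply/subvP => v vU; apply/vlineP; exists (v i j / u i j).
apply/matrixP => k l; rewrite mxE mulrAC.
rewrite (sl2_comm_minors nz2 (tr0 _ uU) (tr0 _ vU) (comU _ _ uU vU)).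
by rewrite mulrAC divff // mul1r.
Qed.

Lemma dim_limg_le (K : fieldType) (V W : vectType K) (f : 'Hom(V, W))
    (U : {vspace V}) : (\dim (f @: U) <= \dim U)%N.
Proof. by rewrite -[leqRHS](limg_ker_dim f) leq_addl. Qed.

(** The block sizes are given explicitly because [4] is only convertible to [2 + 2]. *)
Definition ul_part (K : fieldType) (A : gl K 4) : 'M[K]_2 :=
  @ulsubmx K 2 2 2 2 A.
Definition dr_part (K : fieldType) (A : gl K 4) : 'M[K]_2 :=
  @drsubmx K 2 2 2 2 A.

Fact ul_part_linear (K : fieldType) : linear (@ul_part K).
Proof. by move=> c A B; apply/matrixP => i j; rewrite !mxE. Qed.
Fact dr_part_linear (K : fieldType) : linear (@dr_part K).
Proof. by move=> c A B; apply/matrixP => i j; rewrite !mxE. Qed.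

HB.instance Definition _ (K : fieldType) :=
  GRing.isLinear.Build K (gl K 4) 'M[K]_2 _ (@ul_part K) (@ul_part_linear K).
HB.instance Definition _ (K : fieldType) :=
  GRing.isLinear.Build K (gl K 4) 'M[K]_2 _ (@dr_part K) (@dr_part_linear K).

Lemma so4_abelian_dim (K : fieldType) (W : {vspace gl K 4}) :
  2%:R != 0 :> K -> (W <= so4_vspace K)%VS ->
  {in W &, forall A B, lie A B = 0} -> (\dim W <= 2)%N.
Proof.
move=> nz2 /subvP sW abW.
pose ul : 'Hom(gl K 4, 'M[K]_2) := linfun (@ul_part K).
pose dr : 'Hom(gl K 4, 'M[K]_2) := linfun (@dr_part K).
have blocks A : A \in W -> [/\ \tr (ul A) = 0, \tr (dr A) = 0 &
    A = block_mx (ul A) 0 0 (dr A) :> 'M_(2 + 2)].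
  move=> /sW/mem_so4[a [b [tra trb ->]]].
  by rewrite !lfunE /= /ul_part /dr_part block_mxKul block_mxKdr.
have comW A B : A \in W -> B \in W ->
    ul A *m ul B = ul B *m ul A /\ dr A *m dr B = dr B *m dr A.
  move=> AW BW; have [_ _ eA] := blocks A AW; have [_ _ eB] := blocks B BW.
  (* The bracket of [gl K 4] is the matrix commutator, so its vanishing can be read off block by
     block. *)
  have : block_mx (ul A) 0 0 (dr A) *m block_mx (ul B) 0 0 (dr B) =
      block_mx (ul B) 0 0 (dr B) *m block_mx (ul A) 0 0 (dr A) :> 'M_(2 + 2).
    by rewrite -eA -eB; apply/eqP; rewrite -subr_eq0 -(abW A B AW BW).
  rewrite !mulmx_block !(mulmx0, mul0mx, addr0, add0r).
  by case/eq_block_mx.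
have dul : (\dim (ul @: W) <= 1)%N.
  apply: sl2_comm_dim => //.
    apply/subvP=> _ /memv_imgP[A AW ->]; rewrite mem_sl2.
    by case: (blocks A AW) => ->.
  move=> _ _ /memv_imgP[A AW ->] /memv_imgP[B BW ->].
  by case: (comW A B AW BW).
have ddr : (\dim (dr @: W) <= 1)%N.
  apply: sl2_comm_dim => //.
    apply/subvP=> _ /memv_imgP[A AW ->]; rewrite mem_sl2.
    by case: (blocks A AW) => _ ->.
  move=> _ _ /memv_imgP[A AW ->] /memv_imgP[B BW ->].
  by case: (comW A B AW BW).
pose U1 := (linfun (@ul_block K) @: (ul @: W))%VS.
pose U2 := (linfun (@dr_block K) @: (dr @: W))%VS.
(* Each element of [W] is the sum of its two blocks put back in place, and each summand space has
   dimension at most one. *)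
have /dimvS/leq_trans : (W <= U1 + U2)%VS.
  apply/subvP=> A AW; have [_ _ eA] := blocks A AW.
  have -> : A = linfun (@ul_block K) (ul A) + linfun (@dr_block K) (dr A).
    rewrite !(lfunE (@ul_block K)) !(lfunE (@dr_block K)) [LHS]eA /=.
    rewrite -[RHS]/(block_mx (ul A) 0 0 0 + block_mx 0 0 0 (dr A) : 'M_(2 + 2)).
    by rewrite add_block_mx !(addr0, add0r).
  by rewrite memv_add // !memv_img.
apply; apply: leq_trans (dimv_add_leqif _ _) _.
by rewrite (@leq_add _ _ 1 1) // (leq_trans (dim_limg_le _ _)).
Qed.

(** A linear bijection has zero kernel and full image. *)
Lemma lie_isom_dim (K : fieldType) (L M : lieAlgType K) :
  lie_isom L M -> dim L = dim M.
Proof.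
move=> [f [[g fK gK] _]].
have kf : lker (linfun f) = 0%VS.
  by apply/eqP/lker0P => x y; rewrite !lfunE; exact: (can_inj fK).
rewrite -!dimvf -(@limg_dim_eq _ _ _ (linfun f) fullv) ?kf ?capv0 //.
congr (\dim _); apply/eqP; rewrite eqEsubv subvf /=; apply/subvP=> y _.
by rewrite -(gK y) -[f _]lfunE memv_img ?memvf.
Qed.

Theorem theorem5p4 (R : realType) :
  ~ exists h : lieSubalg (subvs_of (so4 R[i])),
      lie_isom (subvs_of h) (abelian_lie R[i] 3).
Proof.
move=> [h isoh]; have dimh : \dim h = 3 := lie_isom_dim isoh.
have {isoh} abh : {in h &, forall x y, lie x y = 0}.
  move=> x y xh yh; have [f [bijf fM]] := isoh.
  (* Its image under the injective [f] is a bracket in [abelian_lie], which is 0 by definition. *)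
  have /(congr1 val) : lie (Subvs xh) (Subvs yh) = 0.
    by apply: (bij_inj bijf); rewrite fM linear0.
  by [].
(* The dimension bound concerns subspaces of [gl], so [h] is moved there by the inclusion, which is
   injective and keeps its dimension 3. *)
pose inc : 'Hom(subvs_of (so4 R[i]), gl R[i] 4) := linfun vsval.
have kinc : lker inc = 0%VS.
  by apply/eqP/lker0P => x y; rewrite !lfunE; exact: val_inj.
have : (\dim (inc @: h) <= 2)%N.
  apply: so4_abelian_dim; first by rewrite pnatr_eq0.
    by apply/subvP=> _ /memv_imgP[x _ ->]; rewrite lfunE subvsP.
  move=> _ _ /memv_imgP[x xh ->] /memv_imgP[y yh ->]; rewrite !lfunE.
  exact: (congr1 val (abh x y xh yh)).
by rewrite limg_dim_eq ?kinc ?capv0 // dimh.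
Qed.
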